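(* Let $d,d',s$ be positive integers such that every unweighted graph which, for every weight function $\mu$, has a $(d,1)$-coverable balanced separator for $\mu$, admits a tree decomposition whose every bag is $(d',s)$-coverable. Then for every positive integer $r$, every graph which, for every weight function $\mu$, has a $(d,r)$-coverable balanced separator for $\mu$, admits a tree decomposition whose every bag is $(d',4sr+r)$-coverable.
   Context: Graphs are finite, simple, unweighted, with shortest-path distance $\mathrm{dist}$. A set of vertices of a graph $F$ is $(d,\rho)$-coverable if it is contained in the union of $d$ balls $\mathrm{Ball}_F(u,\rho)=\{v:\mathrm{dist}_F(u,v)\le\rho\}$ of $F$. A weight function is a map $\mu:V(F)\to\mathbb{R}_{\ge0}$; $X\subseteq V(F)$ is a balanced separator for $\mu$ if every connected component $C$ of $F-X$ has $\mu(V(C))\le\frac12\mu(V(F))$. *)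

(* Defs.v *)
From HB Require Import structures.
From mathcomp Require Import all_boot all_order all_algebra.
From mathcomp Require Import reals.
Set Implicit Arguments.
Unset Strict Implicit.
Unset Printing Implicit Defensive.
Import Order.TTheory GRing.Theory Num.Theory.

Record sgraph := SGraph {
  vertex :> finType;
  edge : rel vertex;
  edge_sym : symmetric edge;
  edge_irrefl : irreflexive edge }.

Section Distance.
Variable G : sgraph.

Definition walk (u v : G) (n : nat) : bool :=
  [exists p : n.-tuple G, path (@edge G) u p && (last u p == v)].

Lemma connect_walk (u v : G) : connect (@edge G) u v -> exists n, walk u v n.
Proof.
move=> /connectP[p pathp ->]; exists (size p).
by apply/existsP; exists (in_tuple p); rewrite pathp eqxx.
Qed.

(* None stands for infinite distance (distinct connected components). *)
Definition dist (u v : G) : option nat :=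
  match @idP (connect (@edge G) u v) with
  | ReflectT uv => Some (ex_minn (connect_walk uv))
  | ReflectF _ => None
  end.

Definition ball (u : G) (rho : nat) : {set G} :=
  [set v | if dist u v is Some n then n <= rho else false].

(* Centres may repeat in a family of d balls, so at most d distinct centres
   are required; graphs with fewer than d vertices are thus handled. *)
Definition coverable (d rho : nat) (S : {set G}) : Prop :=
  exists2 U : {set G}, #|U| <= d & S \subset \bigcup_(u in U) ball u rho.

Definition induced_edge (A : {set G}) : rel G :=
  [rel x y | [&& x \in A, y \in A & edge x y]].

(* Vertex sets of the connected components of the induced subgraph G[A]. *)
Definition components (A : {set G}) : {set {set G}} :=
  equivalence_partition (connect (induced_edge A)) A.

End Distance.

Definition balanced_separator (R : realType) (G : sgraph) (mu : G -> R)
    (X : {set G}) : Prop :=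
  forall C : {set G}, C \in components (~: X) ->
    (\sum_(v in C) mu v <= 2^-1 * \sum_v mu v)%R.

Definition has_coverable_separators (R : realType) (d rho : nat) (G : sgraph) :
    Prop :=
  forall mu : G -> R, (forall v, 0 <= mu v)%R ->
    exists2 X : {set G}, coverable d rho X & balanced_separator mu X.

Definition is_tree (T : sgraph) : Prop :=
  [/\ 0 < #|T|,
      forall x y : T, connect (@edge T) x y
    & forall c : seq T, ucycle (@edge T) c -> size c <= 2].

Definition tree_decomposition (G T : sgraph) (bag : T -> {set G}) : Prop :=
  [/\ is_tree T,
      forall v : G, exists t, v \in bag t,
      forall u v : G, edge u v -> exists t, (u \in bag t) && (v \in bag t)
    & forall (v : G) (t1 t2 : T), v \in bag t1 -> v \in bag t2 ->
        connect (induced_edge [set t | v \in bag t]) t1 t2].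

Definition has_coverable_tree_decomposition (d rho : nat) (G : sgraph) : Prop :=
  exists (T : sgraph) (bag : T -> {set G}),
    tree_decomposition bag /\ forall t, coverable d rho (bag t).

(* Main.v *)
Require Import Defs.
From mathcomp Require Import all_boot all_order all_algebra.
From mathcomp Require Import reals.

(* Let H join the distinct vertices of G at distance at most 2r.  If X lies in
   the union of the balls Ball_G(u_i, r), put X' = the union of the balls
   Ball_G(u_i, 2r), which is (d,1)-coverable in H.  A walk of G of length at
   most 2r between two vertices outside X' cannot meet X: a common vertex would
   be at distance more than r from both ends.  Hence every component of H - X'
   lies in a component of G - X, and balanced separators transfer from G to H.
   As G is a spanning subgraph of H, a tree decomposition of H is one of G, and
   balls of radius s in H lie in balls of radius 2rs in G. *)

Set Implicit Arguments.
Unset Strict Implicit.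
Unset Printing Implicit Defensive.
Import Order.TTheory GRing.Theory Num.Theory.

Section Balls.
Variable G : sgraph.
Implicit Types u v w : G.

Lemma ballP u v n :
  reflect (exists p, [/\ path (@edge G) u p, last u p = v & size p <= n])
          (v \in ball u n).
Proof.
(* [dist] matches on a proof of [reflect] whose boolean index is the connectivity test itself;
   generalizing that index alone to [b] permits the case analysis. *)
rewrite inE /dist; move: idP; move: {2}(connect _ u v) => b [uv|nuv].
  case: ex_minnP => m walkm minm.
  apply: (iffP idP) => [le_mn|[q [pathq lastq le_qn]]].
    case/existsP: walkm => p /andP[pathp /eqP lastp].
    by exists p; rewrite size_tuple.
  apply: leq_trans le_qn; apply: minm; apply/existsP.
  by exists (in_tuple q); rewrite pathq lastq eqxx.
apply: ReflectF => -[p [pathp lastp _]].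
by apply: nuv; apply/connectP; exists p.
Qed.

Lemma ball_center u n : u \in ball u n.
Proof. by apply/ballP; exists [::]. Qed.

Lemma edge_ball u v n : edge u v -> 0 < n -> v \in ball u n.
Proof. by move=> uv n_gt0; apply/ballP; exists [:: v]; rewrite /= uv. Qed.

Lemma ball_sym u v n : (u \in ball v n) = (v \in ball u n).
Proof.
have sub (x y : G) : x \in ball y n -> y \in ball x n; last first.
  by apply/idP/idP; apply: sub.
(* The reversal of [y :: p] is [last y p :: rev (belast y p)]; its head is the new starting vertex,
   so only the tail is supplied. *)
case/ballP=> p [pathp <- le_pn]; apply/ballP; exists (rev (belast y p)).
rewrite size_rev size_belast; split=> //.
  by rewrite rev_path; under eq_path => a b do rewrite edge_sym.
by case: p {pathp le_pn} => //= z p; rewrite rev_cons last_rcons.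
Qed.

Lemma ball_trans u v w m n :
  v \in ball u m -> w \in ball v n -> w \in ball u (m + n).
Proof.
case/ballP=> p [pathp <- le_pm] /ballP[q [pathq <- le_qn]].
apply/ballP; exists (p ++ q).
by rewrite cat_path pathp pathq last_cat size_cat leq_add.
Qed.

Lemma ball_subset u m n : m <= n -> ball u m \subset ball u n.
Proof.
move=> le_mn; apply/subsetP => v /ballP[p [pathp lastp le_pm]].
by apply/ballP; exists p; rewrite (leq_trans le_pm).
Qed.

Lemma coverable_leq d m n (S : {set G}) :
  m <= n -> coverable d m S -> coverable d n S.
Proof.
move=> le_mn [U cardU /subsetP SU]; exists U => //.
apply/subsetP => v /SU/bigcupP[u uU vu]; apply/bigcupP; exists u => //.
exact: subsetP (ball_subset u le_mn) v vu.
Qed.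

(** By the triangle inequality, a vertex [z] of the walk within [n] of [u] is more than [n] steps
    away from both ends, so the two pieces into which [z] cuts the walk are together longer than
    [n + n]. *)
Lemma short_path_avoids_ball u x y p n :
    x \notin ball u (n + n) -> y \notin ball u (n + n) ->
    path (@edge G) x p -> last x p = y -> size p <= n + n ->
  forall z, z \in x :: p -> z \notin ball u n.
Proof.
move=> xu yu pathp lastp le_p z /splitPl zp.
case: zp pathp lastp le_p => p1 p2 lastp1.
rewrite cat_path last_cat lastp1 size_cat => /andP[path1 path2] last2 le_p.
apply/negP => zu.
have lt_n1 : n < size p1.
  rewrite ltnNge; apply: contra xu => le_1n; apply: ball_trans zu _.
  by rewrite ball_sym; apply/ballP; exists p1.
have lt_n2 : n < size p2.
  rewrite ltnNge; apply: contra yu => le_2n; apply: ball_trans zu _.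
  by apply/ballP; exists p2.
by have := leq_add lt_n1 (ltnW lt_n2); rewrite addSn ltnNge le_p.
Qed.

End Balls.

Lemma path_connect_induced (G : sgraph) (A : {set G}) x p :
    path (@edge G) x p -> {subset x :: p <= A} ->
  connect (induced_edge A) x (last x p).
Proof.
elim: p x => [|y p IHp] x /=; first by rewrite connect0.
case/andP=> xy pathp sub.
apply: (connect_trans (y := y)).
  by apply: connect1; rewrite /induced_edge /= xy !sub ?inE ?eqxx ?orbT.
by apply: IHp => // z zp; apply: sub; rewrite inE zp orbT.
Qed.

Section PowerGraph.
Variables (G : sgraph) (n : nat).

Definition power_edge : rel G := [rel u v | (u != v) && (v \in ball u n)].

Lemma power_edge_sym : symmetric power_edge.
Proof. by move=> u v; rewrite /power_edge /= eq_sym ball_sym. Qed.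

Lemma power_edge_irrefl : irreflexive power_edge.
Proof. by move=> u; rewrite /power_edge /= eqxx. Qed.

Definition power_graph := SGraph power_edge_sym power_edge_irrefl.

Lemma edge_power (u v : G) : 0 < n -> edge u v -> power_edge u v.
Proof.
move=> n_gt0 uv; rewrite /power_edge /= edge_ball // andbT.
by apply: contraTneq uv => ->; rewrite edge_irrefl.
Qed.

Lemma ball_power_graph1 (u : G) : ball u n \subset @ball power_graph u 1.
Proof.
apply/subsetP => v vu; have [<-|neq_uv] := eqVneq u v; first exact: ball_center.
by apply: (@edge_ball power_graph) => //; rewrite /= /power_edge /= neq_uv.
Qed.

Lemma ball_power_graph (u : G) m : @ball power_graph u m \subset ball u (n * m).
Proof.
apply/subsetP => v /(@ballP power_graph)[p [pathp lastp le_pm]].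
(* Passing to the radius [n * size p] first lets the induction on [p] charge exactly [n] per edge of
   the power graph. *)
apply: (subsetP (ball_subset u (leq_mul (leqnn n) le_pm))).
elim: p u pathp lastp {le_pm} => [|w p IHp] u /=.
  by move=> _ ->; apply: ball_center.
case/andP=> /andP[_ wu] pathp lastp; rewrite mulnS.
exact: ball_trans wu (IHp _ pathp lastp).
Qed.

Lemma coverable_power_graph d m (S : {set G}) :
  @coverable power_graph d m S -> coverable d (n * m) S.
Proof.
case=> U cardU /subsetP SU; exists U => //.
apply/subsetP => v /SU/bigcupP[u uU vu]; apply/bigcupP; exists u => //.
exact: subsetP (ball_power_graph u m) v vu.
Qed.

(** Only the edge condition depends on the edges of the graph, and for [0 < n] every edge of [G] is
    an edge of the power; the other conditions concern the tree and the common vertex set. *)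
Lemma tree_decomposition_power_graph (T : sgraph) (bag : T -> {set G}) :
  0 < n -> @tree_decomposition power_graph T bag -> tree_decomposition bag.
Proof.
move=> n_gt0 [treeT cover_vertex cover_edge conn]; split=> // u v uv.
exact: cover_edge (edge_power n_gt0 uv).
Qed.

End PowerGraph.

Lemma components_power_graph (G : sgraph) r (U X : {set G})
    (C : {set power_graph G (r + r)}) :
    X \subset \bigcup_(u in U) ball u r ->
    C \in components
            (~: (\bigcup_(u in U) ball u (r + r)) : {set power_graph _ _}) ->
  exists2 D, D \in components (~: X) & C \subset D.
Proof.
set X' := (\bigcup_(u in U) ball u (r + r)) => /subsetP XU.
have far (x u : G) : x \in ~: X' -> u \in U -> x \notin ball u (r + r).
  by rewrite inE => xX' uU; apply: contra xX' => xu; apply/bigcupP; exists u.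
have sub x : x \in ~: X' -> x \in ~: X.
  rewrite !inE; apply: contra => /XU/bigcupP[u uU xu]; apply/bigcupP.
  by exists u => //; apply: subsetP (ball_subset u (leq_addr r r)) x xu.
(* An edge of the power graph outside [X'] unfolds to a walk of [G] that avoids every [ball u r]
   with [u] in [U], hence avoids [X]. *)
have conn1 (x y : G) : @induced_edge (power_graph G (r + r)) (~: X') x y ->
    connect (induced_edge (~: X)) x y.
  case/and3P=> xX' yX' /andP[_ /ballP[p [pathp lastp le_p]]].
  rewrite -lastp; apply: path_connect_induced => // z zp.
  rewrite inE; apply/negP => /XU/bigcupP[u uU]; apply/negP.
  by apply: short_path_avoids_ball pathp lastp le_p z zp; apply: far.
case/imsetP=> x xX' ->.
(* A representative [x] of [C] also lies outside [X], so its class in [G - X] serves as [D]. *)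
exists [set y in ~: X | connect (induced_edge (~: X)) x y].
  by apply/imsetP; exists x => //; apply: sub.
apply/subsetP => y; rewrite 2!inE => /andP[yX' xy]; rewrite inE sub ?inE //=.
exact: connect_sub conn1 _ _ xy.
Qed.

Lemma has_coverable_separators_power_graph (R : realType) d r (G : sgraph) :
    has_coverable_separators R d r G ->
  has_coverable_separators R d 1 (power_graph G (r + r)).
Proof.
move=> sepG mu mu_ge0; have [X [U cardU XU] sepX] := sepG mu mu_ge0.
exists (\bigcup_(u in U) ball u (r + r)).
  exists U => //; apply/bigcupsP => u uU.
  exact: subset_trans (ball_power_graph1 _ u) (bigcup_sup u uU).
move=> C /(components_power_graph XU)[D compD /subsetP CD].
apply: le_trans (sepX D compD).
(* Both sums become sums over all vertices, compared termwise; nonnegativity of [mu] settles the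
   vertices of [D] outside [C]. *)
rewrite big_mkcond [leRHS]big_mkcond; apply: ler_sum => v _.
by case: ifP => [/CD ->|_] //; case: ifP.
Qed.

Theorem theorem6p3 (R : realType) (d d' s : nat)
  (hd : 0 < d) (hd' : 0 < d') (hs : 0 < s)
  (hyp : forall G : sgraph, has_coverable_separators R d 1 G ->
           has_coverable_tree_decomposition d' s G)
  (r : nat) (hr : 0 < r) (G : sgraph)
  (hG : has_coverable_separators R d r G) :
  has_coverable_tree_decomposition d' (4 * s * r + r) G.
Proof.
have [T [bag [decT covT]]] := hyp _ (has_coverable_separators_power_graph hG).
exists T, bag; split=> [|t].
  by apply: tree_decomposition_power_graph decT; rewrite addn_gt0 hr.
apply: coverable_leq (coverable_power_graph (covT t)).
(* The radius obtained is [(r + r) * s], that is [2 * (s * r)], which is at most [4 * (s * r)]. *)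
rewrite addnn -mul2n mulnAC -mulnA -mulnA.
by rewrite (leq_trans _ (leq_addr _ _)) // leq_mul2r orbT.
Qed.
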